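(* Let $A,H$ be Hopf algebras forming a bicrossproduct $A\blacktriangleright\!\!\!\triangleleft H$ with left action $\triangleright:H\otimes A\to A$ and right coaction $\beta:H\to H\otimes A$, $\beta(h)=h^{(0)}\otimes h^{(1)}$. Let $\Omega(A),\Omega(H)$ be strongly bicovariant exterior algebras such that $\triangleright$ extends to a degree-preserving $\triangleright:\Omega(H)\underline\otimes\Omega(A)\to\Omega(A)$ making $\Omega(A)$ a super left $\Omega(H)$-module algebra, and $\beta$ extends to a degree-preserving super coaction $\beta_*:\Omega(H)\to\Omega(H)\underline\otimes\Omega(A)$, $\beta_*(\eta)=\eta^{(0)}\otimes\eta^{(1)}$, making $\Omega(H)$ a super right $\Omega(A)$-comodule coalgebra, obeying for all $\eta,\xi\in\Omega(H)$, $\omega\in\Omega(A)$: $$d_A(\eta\triangleright\omega)=(d_H\eta)\triangleright\omega+(-1)^{|\eta|}\eta\triangleright(d_A\omega),$$ $$\beta_*(d_H\eta)=d_H\eta^{(0)}\otimes\eta^{(1)}+(-1)^{|\eta^{(0)}|}\eta^{(0)}\otimes d_A\eta^{(1)},$$ $$\epsilon(\eta\triangleright\omega)=\epsilon(\eta)\epsilon(\omega),$$ $$\Delta_*(\eta\triangleright\omega)=(-1)^{(|\eta_{(1)}{}^{(1)}|+|\eta_{(2)}|)|\omega_{(1)}|}\eta_{(1)}{}^{(0)}\triangleright\omega_{(1)}\otimes\eta_{(1)}{}^{(1)}(\eta_{(2)}\triangleright\omega_{(2)}),$$ $$\beta_*(\eta\xi)=(-1)^{(|\eta_{(1)}{}^{(1)}|+|\eta_{(2)}|)|\xi^{(0)}|}\eta_{(1)}{}^{(0)}\xi^{(0)}\otimes\eta_{(1)}{}^{(1)}(\eta_{(2)}\triangleright\xi^{(1)}),$$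 $$(-1)^{|\omega||\eta_{(2)}{}^{(1)}|+|\eta_{(1)}||\eta_{(2)}{}^{(0)}|}\eta_{(2)}{}^{(0)}\otimes(\eta_{(1)}\triangleright\omega)\eta_{(2)}{}^{(1)}=\eta_{(1)}{}^{(0)}\otimes\eta_{(1)}{}^{(1)}(\eta_{(2)}\triangleright\omega).$$ Let $A\blacktriangleright\!\!\!\triangleleft H$ have the exterior algebra $\Omega(A)\blacktriangleright\!\!\!\triangleleft\Omega(H)$ with $d(\omega\otimes\eta)=d_A\omega\otimes\eta+(-1)^{|\omega|}\omega\otimes d_H\eta$. Then the right coaction $\Delta_R:H\to H\otimes(A\blacktriangleright\!\!\!\triangleleft H)$, $\Delta_Rh=h_{(1)}{}^{(0)}\otimes h_{(1)}{}^{(1)}\otimes h_{(2)}$, is differentiable.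
   Context: Work over a field $k$. An exterior algebra on an algebra $A$ is a differential graded algebra $\Omega(A)=\oplus_{n\ge0}\Omega^n(A)$ with $\Omega^0=A$, generated by $A$ and $\Omega^1=\mathrm{span}\{a\,db\}$, with $d^2=0$ and graded Leibniz rule. The super tensor product $\underline\otimes$ has product $(a\otimes b)(c\otimes d)=(-1)^{|b||c|}ac\otimes bd$ and differential $d\otimes\mathrm{id}+(-1)^{|\ |}\mathrm{id}\otimes d$, $(-1)^{|\ |}\omega=(-1)^{|\omega|}\omega$. $\Omega(A)$ on a Hopf algebra $A$ is strongly bicovariant if it is a super-Hopf algebra (grade = form degree mod 2) with coproduct $\Delta_*$ preserving total degree, restricting to $\Delta$ on $A$, and $\Delta_*d\omega=(d\otimes\mathrm{id}+(-1)^{|\ |}\mathrm{id}\otimes d)\Delta_*\omega$. A right coaction $\Delta_R:B\to B\otimes K$ making $B$ a $K$-comodule algebra is differentiable (for exterior algebras $\Omega(B),\Omega(K)$) if it extends to a total-degree-preserving DGA map $\Delta_{R*}:\Omega(B)\to\Omega(B)\underline\otimes\Omega(K)$. Sweedler notation is with homogeneous components. Super left module algebra: $\eta\triangleright(\omega\tau)=(-1)^{|\eta_{(2)}||\omega|}(\eta_{(1)}\triangleright\omega)(\eta_{(2)}\triangleright\tau)$, $\eta\triangleright1=\epsilon(\eta)1$. Super right comodule coalgebra: $(\Delta_*\otimes\mathrm{id})\beta_*(\eta)=(-1)^{|\eta_{(2)}{}^{(0)}||\eta_{(1)}{}^{(1)}|}\eta_{(1)}{}^{(0)}\otimes\eta_{(2)}{}^{(0)}\otimes\eta_{(1)}{}^{(1)}\eta_{(2)}{}^{(1)}$,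 with counit condition. Bicrossproduct $A\blacktriangleright\!\!\!\triangleleft H$: $A$ is a left $H$-module algebra by $\triangleright$, $H$ is a right $A$-comodule coalgebra by $\beta$, compatible (the last four displayed conditions of the claim restricted to degree 0, and $\beta(1)=1\otimes1$), so that $A\otimes H$ with $(a\otimes h)(b\otimes g)=a(h_{(1)}\triangleright b)\otimes h_{(2)}g$ and $\Delta(a\otimes h)=a_{(1)}\otimes h_{(1)}{}^{(0)}\otimes a_{(2)}h_{(1)}{}^{(1)}\otimes h_{(2)}$ is a Hopf algebra. The super bicrossproduct $\Omega(A)\blacktriangleright\!\!\!\triangleleft\Omega(H)$ is $\Omega(A)\otimes\Omega(H)$ with $$(\omega\otimes\eta)(\tau\otimes\xi)=(-1)^{|\eta_{(2)}||\tau|}\omega(\eta_{(1)}\triangleright\tau)\otimes\eta_{(2)}\xi,\qquad\Delta_*(\omega\otimes\eta)=(-1)^{|\omega_{(2)}||\eta_{(1)}{}^{(0)}|}\omega_{(1)}\otimes\eta_{(1)}{}^{(0)}\otimes\omega_{(2)}\eta_{(1)}{}^{(1)}\otimes\eta_{(2)}.$$ *)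

(* Defs.v *)
From HB Require Import structures.
From mathcomp Require Import all_boot all_order all_algebra.
From mathcomp Require Import boolp.

Set Implicit Arguments.
Unset Strict Implicit.
Unset Printing Implicit Defensive.

Import GRing.Theory.
Local Open Scope ring_scope.
Local Open Scope quotient_scope.

(** Elements are formal sums of pairs [(u, v)]; two formal sums are identified
    when no bilinear map into a vector space separates them.  Testing against
    the free vector space on [U * V] modulo the bilinearity relations shows
    that this is the usual quotient; [tliftE] is the universal property. *)
Section Tensor.
Variables (k : fieldType) (U V : lmodType k).

Definition fsum (W : lmodType k) (f : U -> V -> W) (s : seq (U * V)) : W :=
  \sum_(p <- s) f p.1 p.2.

Definition teqv : rel (seq (U * V)) := fun s t =>
  `[< forall (W : lmodType k) (f : {bilinear U -> V -> W}),
        fsum f s = fsum f t >].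

Lemma teqvP s t :
  reflect (forall (W : lmodType k) (f : {bilinear U -> V -> W}),
             fsum f s = fsum f t) (teqv s t).
Proof. exact: asboolP. Qed.

Lemma teqv_refl : reflexive teqv. Proof. by move=> s; apply/teqvP. Qed.

Lemma teqv_sym : symmetric teqv.
Proof. by move=> s t; apply/teqvP/teqvP => h W f; rewrite h. Qed.

Lemma teqv_trans : transitive teqv.
Proof. by move=> t s r /teqvP h1 /teqvP h2; apply/teqvP => W f; rewrite h1. Qed.

Canonical teqv_equiv := EquivRel teqv teqv_refl teqv_sym teqv_trans.

Definition tensor := {eq_quot teqv}.
HB.instance Definition _ := Choice.on tensor.
HB.instance Definition _ := EqQuotient.on tensor.

Definition tlift (W : lmodType k) (f : U -> V -> W) (x : tensor) : W :=
  fsum f (repr x).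

Definition tpure (u : U) (v : V) : tensor := \pi_tensor [:: (u, v)].

Let tadd (x y : tensor) : tensor := \pi_tensor (repr x ++ repr y).
Let tzero : tensor := \pi_tensor [::].
Let tscale (c : k) (x : tensor) : tensor :=
  \pi_tensor [seq (c *: p.1, p.2) | p <- repr x].

Lemma tensorP (x y : tensor) :
  (forall (W : lmodType k) (f : {bilinear U -> V -> W}),
     tlift f x = tlift f y) -> x = y.
Proof. by move=> h; rewrite -[x]reprK -[y]reprK; apply/eqmodP/teqvP. Qed.

Let tlift_pi (W : lmodType k) (f : {bilinear U -> V -> W}) s :
  tlift f (\pi_tensor s) = fsum f s.
Proof.
have /eqmodP/teqvP h : repr (\pi_tensor s) = s %[mod tensor] by rewrite reprK.
exact: h.
Qed.

Let tlift_add (W : lmodType k) (f : {bilinear U -> V -> W}) x y :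
  tlift f (tadd x y) = tlift f x + tlift f y.
Proof. by rewrite tlift_pi /fsum big_cat. Qed.

Let tlift_zero (W : lmodType k) (f : {bilinear U -> V -> W}) :
  tlift f tzero = 0.
Proof. by rewrite tlift_pi /fsum big_nil. Qed.

Let tlift_scale (W : lmodType k) (f : {bilinear U -> V -> W}) c x :
  tlift f (tscale c x) = c *: tlift f x.
Proof.
rewrite tlift_pi /fsum big_map scaler_sumr; apply: eq_bigr => p _ /=.
by rewrite linearZl_LR.
Qed.

Let taddA : associative tadd.
Proof. by move=> x y z; apply: tensorP => W f; rewrite !tlift_add addrA. Qed.
Let taddC : commutative tadd.
Proof. by move=> x y; apply: tensorP => W f; rewrite !tlift_add addrC. Qed.
Let tadd0 : left_id tzero tadd.
Proof.
by move=> x; apply: tensorP => W f; rewrite tlift_add tlift_zero add0r.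
Qed.
Let taddN : left_inverse tzero (tscale (-1)) tadd.
Proof.
move=> x; apply: tensorP => W f.
by rewrite tlift_add tlift_scale tlift_zero scaleN1r addNr.
Qed.

HB.instance Definition _ := GRing.isZmodule.Build tensor taddA taddC tadd0 taddN.

Let tscaleA a b x : tscale a (tscale b x) = tscale (a * b) x.
Proof. by apply: tensorP => W f; rewrite !tlift_scale scalerA. Qed.
Let tscale1 : left_id 1 tscale.
Proof. by move=> x; apply: tensorP => W f; rewrite tlift_scale scale1r. Qed.
Let tscaleDr : right_distributive tscale +%R.
Proof.
move=> c x y; apply: tensorP => W f.
by rewrite tlift_scale !tlift_add !tlift_scale scalerDr.
Qed.
Let tscaleDl x : {morph tscale^~ x : a b / a + b}.
Proof.
move=> a b; apply: tensorP => W f.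
by rewrite tlift_add !tlift_scale scalerDl.
Qed.

HB.instance Definition _ :=
  GRing.Zmodule_isLmodule.Build k tensor tscaleA tscale1 tscaleDr tscaleDl.

Section Lift.
Variables (W : lmodType k) (f : U -> V -> W).
Hypothesis f_bil : bilinear_for *:%R *:%R f.

Let fB : {bilinear U -> V -> W} :=
  HB.pack f (bilinear_isBilinear.Build k U V W *:%R *:%R f f_bil).

Lemma tlift_linear : linear (tlift f).
Proof.
move=> c x y; rewrite -[f]/(fB : _ -> _ -> _).
by rewrite (tlift_add fB) (tlift_scale fB).
Qed.

Lemma tliftE u v : tlift f (tpure u v) = f u v.
Proof. by rewrite -[f]/(fB : _ -> _ -> _) tlift_pi /fsum big_seq1. Qed.

End Lift.

Lemma tpure_bilinear : bilinear_for *:%R *:%R tpure.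
Proof.
split=> [v c u u' | u c v v']; apply: tensorP => W f; symmetry.
- by rewrite (tlift_add f) (tlift_scale f) !tlift_pi /fsum !big_seq1 /= linearPl.
- by rewrite (tlift_add f) (tlift_scale f) !tlift_pi /fsum !big_seq1 /= linearPr.
Qed.

Lemma tensor_ind (P : tensor -> Prop) :
  P 0 -> (forall x y, P x -> P y -> P (x + y)) ->
  (forall u v, P (tpure u v)) -> forall x, P x.
Proof.
move=> P0 PD Pp x; rewrite -[x]reprK; elim: (repr x) => [|[u v] s IHs] //.
suff -> : \pi_tensor ((u, v) :: s) = tpure u v + \pi_tensor s by apply: PD.
apply: tensorP => W f.
by rewrite (tlift_add f) !tlift_pi /fsum big_cons big_seq1.
Qed.

End Tensor.

Arguments tensor {k} (U V)%_type_scope.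

Notation "U \ox V" := (tensor U V) (at level 40, left associativity) : type_scope.
Notation "u \ox v" := (tpure u v) (at level 40, left associativity) : ring_scope.

HB.instance Definition _ (k : fieldType) (U V : lmodType k) :=
  bilinear_isBilinear.Build k U V (U \ox V)%type *:%R *:%R
    (@tpure k U V) (tpure_bilinear U V).

(** [\tsum_(a, b <- x) E] is the Sweedler-style value of [E] on
    [x = sum a (x) b]; it is meaningful for [E] bilinear in [a] and [b]. *)
Notation "\tsum_ ( a , b <- x ) E" := (tlift (fun a b => E) x)
  (at level 41, E at level 41, a name, b name, x at level 200,
   format "'[' \tsum_ ( a ,  b  <-  x ) '/  '  E ']'") : ring_scope.

Definition tmap (k : fieldType) (U V U' V' : lmodType k)
    (f : U -> U') (g : V -> V') (x : U \ox V) : U' \ox V' :=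
  \tsum_(u, v <- x) f u \ox g v.

(** A grading [V = (+)_n V^n] is given by the projections onto the [V^n]. *)

HB.mixin Record isGraded (k : fieldType) V of GRing.Lmodule k V := {
  gpr : nat -> {linear V -> V};
  gprK : forall m n (x : V), gpr m (gpr n x) = if m == n then gpr n x else 0;
  gpr_sum : forall x : V, exists N, x = \sum_(n < N) gpr n x
}.

#[short(type="gmodType")]
HB.structure Definition GradedModule (k : fieldType) :=
  {V of GRing.Lmodule k V & isGraded k V}.

Definition homog (k : fieldType) (V : gmodType k) (n : nat) (x : V) : Prop :=
  gpr n x = x.

Definition degree_preserving (k : fieldType) (V W : gmodType k)
    (f : V -> W) : Prop :=
  forall n x, homog n x -> homog n (f x).

Definition parity_preserving (k : fieldType) (V W : gmodType k)
    (f : V -> W) : Prop :=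
  forall m n x, homog m x -> odd n != odd m -> gpr n (f x) = 0.

(** An arbitrary bound on the degrees occurring in [x]; sums up to [gbound x]
    do not depend on the choice, see [gbound_widen]. *)
Definition gbound (k : fieldType) (V : gmodType k) (x : V) : nat :=
  projT1 (cid (gpr_sum x)).

Section GradedTheory.
Variables (k : fieldType) (V : gmodType k).
Implicit Types x : V.

Lemma gpr_homog m n x : homog n x -> gpr m x = if m == n then x else 0.
Proof. by move=> h; rewrite -h gprK; case: eqP. Qed.

Lemma homog_gpr n x : homog n (gpr n x).
Proof. by rewrite /homog gprK eqxx. Qed.

Lemma homog_sum x : x = \sum_(n < gbound x) gpr n x.
Proof. exact: projT2 (cid (gpr_sum x)). Qed.

Lemma gpr_ge_bound n x : (gbound x <= n)%N -> gpr n x = 0.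
Proof.
move=> le_n; rewrite [in LHS](homog_sum x) linear_sum big1 // => i _.
by rewrite /= gprK gtn_eqF // (leq_trans (ltn_ord i)).
Qed.

Lemma gbound_widen (W : zmodType) (F : nat -> V -> W) x N :
  (forall n, F n 0 = 0) -> (gbound x <= N)%N ->
  \sum_(n < gbound x) F n (gpr n x) = \sum_(n < N) F n (gpr n x).
Proof.
move=> F0 le_N; rewrite (big_ord_widen N (fun n => F n (gpr n x)) le_N).
rewrite big_mkcond /=; apply: eq_bigr => n _; case: ltnP => // h.
by rewrite gpr_ge_bound // F0.
Qed.

Lemma gbound_linear (W : lmodType k) (F : nat -> V -> W) :
  (forall n, linear (F n)) ->
  linear (fun x => \sum_(n < gbound x) F n (gpr n x)).
Proof.
move=> FL c x y.
have F0 n : F n 0 = 0 by have := FL n (-1) 0 0; rewrite scaler0 addr0 scaleN1r addNr.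
set N := maxn (gbound (c *: x + y)) (maxn (gbound x) (gbound y)).
rewrite !(@gbound_widen _ F _ N) ?leq_max ?leqnn ?orbT // scaler_sumr -big_split.
by apply: eq_bigr => n _; rewrite /= linearP FL.
Qed.

Lemma gbound_homog (W : zmodType) (F : nat -> V -> W) n x :
  (forall n, F n 0 = 0) -> homog n x ->
  \sum_(i < gbound x) F i (gpr i x) = F n x.
Proof.
move=> F0 hx; rewrite (@gbound_widen _ F _ (maxn (gbound x) n.+1)) ?leq_maxl //.
have ltn : (n < maxn (gbound x) n.+1)%N by rewrite leq_max leqnn orbT.
rewrite (bigD1 (Ordinal ltn)) //= (gpr_homog _ hx) eqxx big1 ?addr0 // => i ne.
by rewrite (gpr_homog _ hx) -[_ == n]/(i == Ordinal ltn) (negbTE ne) F0.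
Qed.

End GradedTheory.

(** [\hsum_(a @ i, b @ j <- x) E] is the Sweedler-style value of [E] on
    [x = sum a (x) b], the sum running over homogeneous components [a] and [b]
    of respective degrees [i] and [j]. *)
Definition hsum (k : fieldType) (U V : gmodType k) (W : lmodType k)
    (F : nat -> nat -> U -> V -> W) (x : U \ox V) : W :=
  \tsum_(u, v <- x)
    \sum_(i < gbound u) \sum_(j < gbound v) F i j (gpr i u) (gpr j v).

Notation "\hsum_ ( a @ i , b @ j <- x ) E" := (hsum (fun i j a b => E) x)
  (at level 41, E at level 41, a name, b name, i name, j name, x at level 200,
   format "'[' \hsum_ ( a  @  i ,  b  @  j  <-  x ) '/  '  E ']'") : ring_scope.

Section HomogeneousSum.
Variables (k : fieldType) (U V : gmodType k) (W : lmodType k).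
Variable F : nat -> nat -> U -> V -> W.
Hypothesis F_bil : forall i j, bilinear_for *:%R *:%R (F i j).

Let F0l i j v : F i j 0 v = 0.
Proof.
by have := (F_bil i j).1 v (-1) 0 0; rewrite /= scaler0 addr0 scaleN1r addNr.
Qed.
Let F0r i j u : F i j u 0 = 0.
Proof.
by have := (F_bil i j).2 u (-1) 0 0; rewrite /= scaler0 addr0 scaleN1r addNr.
Qed.

Let hsum_bil : bilinear_for *:%R *:%R (fun u v =>
  \sum_(i < gbound u) \sum_(j < gbound v) F i j (gpr i u) (gpr j v)).
Proof.
split=> [v | u].
- apply: (@gbound_linear _ _ _ (fun i a => \sum_(j < gbound v) F i j a (gpr j v))).
  move=> i c x y; rewrite scaler_sumr -big_split; apply: eq_bigr => j _ /=.
  exact: (F_bil i j).1.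
- move=> c x y /=.
  have E v : \sum_(i < gbound u) \sum_(j < gbound v) F i j (gpr i u) (gpr j v) =
             \sum_(j < gbound v) \sum_(i < gbound u) F i j (gpr i u) (gpr j v).
    exact: exchange_big.
  rewrite !E; move: c x y.
  apply: (@gbound_linear _ _ _ (fun j b => \sum_(i < gbound u) F i j (gpr i u) b)).
  move=> j a v w; rewrite scaler_sumr -big_split; apply: eq_bigr => i _ /=.
  exact: (F_bil i j).2.
Qed.

Lemma hsum_linear : linear (hsum F).
Proof. exact: tlift_linear. Qed.

Lemma hsumE i j u v : homog i u -> homog j v -> hsum F (u \ox v) = F i j u v.
Proof.
move=> hu hv; rewrite /hsum tliftE //.
rewrite (@gbound_homog _ _ _
  (fun i a => \sum_(j < gbound v) F i j a (gpr j v)) i) //.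
  by rewrite (@gbound_homog _ _ _ (fun j b => F i j u b) j).
by move=> n; rewrite big1.
Qed.

End HomogeneousSum.

Lemma homog_tensor_ind (k : fieldType) (U V : gmodType k) (P : U \ox V -> Prop) :
  P 0 -> (forall x y, P x -> P y -> P (x + y)) ->
  (forall i j u v, homog i u -> homog j v -> P (u \ox v)) -> forall x, P x.
Proof.
move=> P0 PD Pp; apply: tensor_ind => // u v.
rewrite (homog_sum u) (homog_sum v) linear_sumlz; apply: big_ind => // i _.
rewrite /= linear_sumr; apply: big_ind => // j _; apply: Pp; exact: homog_gpr.
Qed.

Section TensorGrading.
Variables (k : fieldType) (U V : gmodType k).

Definition tgpr (n : nat) (x : U \ox V) : U \ox V :=
  \hsum_(u @ i, v @ j <- x) (if (i + j == n)%N then u \ox v else 0).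

Let tgpr_bil n i j : bilinear_for *:%R *:%R
  (fun (u : U) (v : V) => if (i + j == n)%N then u \ox v else 0).
Proof.
case: eqP => _; first exact: tpure_bilinear.
by split=> [? c ? ? | ? c ? ?] /=; rewrite scaler0 addr0.
Qed.

Lemma tgpr_linear n : linear (tgpr n).
Proof. exact: hsum_linear. Qed.

HB.instance Definition _ n :=
  GRing.isLinear.Build k (U \ox V)%type (U \ox V)%type *:%R (tgpr n)
    (@tgpr_linear n).

Let tgprE n i j u v : homog i u -> homog j v ->
  tgpr n (u \ox v) = if (i + j == n)%N then u \ox v else 0.
Proof. by move=> hu hv; rewrite /tgpr (hsumE _ hu hv). Qed.

Let tgprK m n x : tgpr m (tgpr n x) = if m == n then tgpr n x else 0.
Proof.
move: x; apply: homog_tensor_ind => [|x y hx hy|i j u v hu hv].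
- by rewrite !linear0 if_same.
- by rewrite !linearD /= hx hy; case: eqP; rewrite ?addr0.
- rewrite (tgprE n hu hv); case: eqP => [<-|_]; last by rewrite linear0 if_same.
  by rewrite (tgprE m hu hv) eq_sym.
Qed.

Let tgpr_sum x : exists N, x = \sum_(n < N) tgpr n x.
Proof.
suff [N hN] : exists N, forall M, (N <= M)%N -> x = \sum_(n < M) tgpr n x.
  by exists N; apply: hN.
move: x; apply: homog_tensor_ind => [|x y [N hN] [N' hN']|i j u v hu hv].
- by exists 0 => M _; rewrite big1 // => n _; rewrite linear0.
- exists (maxn N N') => M; rewrite geq_max => /andP[/hN {1}-> /hN' {1}->].
  by rewrite -big_split; apply: eq_bigr => n _; rewrite linearD.
- exists (i + j).+1 => M lt_M; rewrite (bigD1 (Ordinal lt_M)) //=.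
  rewrite (tgprE _ hu hv) eqxx big1 ?addr0 // => n ne.
  by rewrite (tgprE _ hu hv) eq_sym -[_ == _]/(n == Ordinal lt_M) (negbTE ne).
Qed.

HB.instance Definition _ := isGraded.Build k (U \ox V)%type tgprK tgpr_sum.

End TensorGrading.

Definition tensor_mul (k : fieldType) (U V : lmodType k)
    (mU : U -> U -> U) (mV : V -> V -> V) (x y : U \ox V) : U \ox V :=
  \tsum_(a, b <- x) \tsum_(c, e <- y) mU a c \ox mV b e.

Definition super_tensor_mul (k : fieldType) (U V : gmodType k)
    (mU : U -> U -> U) (mV : V -> V -> V) (x y : U \ox V) : U \ox V :=
  \hsum_(a @ i, b @ j <- x) \hsum_(c @ p, e @ q <- y)
    (-1) ^+ (j * p) *: (mU a c \ox mV b e).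

Definition super_tensor_d (k : fieldType) (U V : gmodType k)
    (dU : U -> U) (dV : V -> V) (x : U \ox V) : U \ox V :=
  \hsum_(a @ i, b @ j <- x) (dU a \ox b + (-1) ^+ i *: (a \ox dV b)).

HB.mixin Record isHopf (k : fieldType) A of GRing.Algebra k A := {
  comul : {linear A -> (A \ox A)%type};
  counit : {scalar A};
  antipode : {linear A -> A};
  comulA : forall x : A,
    \tsum_(a, b <- comul x) \tsum_(c, e <- comul b) a \ox (c \ox e) =
    \tsum_(a, b <- comul x) \tsum_(c, e <- comul a) c \ox (e \ox b);
  counit_comull : forall x : A, \tsum_(a, b <- comul x) counit a *: b = x;
  counit_comulr : forall x : A, \tsum_(a, b <- comul x) counit b *: a = x;
  comul1 : comul 1 = 1 \ox 1;
  comulM : forall x y : A, comul (x * y) = tensor_mul *%R *%R (comul x) (comul y);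
  counit1 : counit 1 = 1;
  counitM : forall x y : A, counit (x * y) = counit x * counit y;
  antipodel : forall x : A, \tsum_(a, b <- comul x) antipode a * b = (counit x)%:A;
  antipoder : forall x : A, \tsum_(a, b <- comul x) a * antipode b = (counit x)%:A
}.

#[short(type="hopfAlgType")]
HB.structure Definition HopfAlgebra (k : fieldType) :=
  {A of GRing.Algebra k A & isHopf k A}.

HB.mixin Record isGradedAlgebra (k : fieldType) Om
    of GRing.Algebra k Om & isGraded k Om := {
  homog1 : homog 0 (1 : Om);
  homogM : forall m n (x y : Om), homog m x -> homog n y -> homog (m + n) (x * y)
}.

#[short(type="gradedAlgType")]
HB.structure Definition GradedAlgebra (k : fieldType) :=
  {Om of GRing.Algebra k Om & isGraded k Om & isGradedAlgebra k Om}.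

HB.mixin Record isExterior (k : fieldType) (A : algType k) Om
    of GradedAlgebra k Om := {
  ext_incl : {lrmorphism A -> Om};
  ext_incl_inj : injective ext_incl;
  ext_incl_deg0 : forall x : Om, homog 0 x <-> exists a, x = ext_incl a;
  extd : {linear Om -> Om};
  homog_extd : forall n (x : Om), homog n x -> homog n.+1 (extd x);
  extd_extd : forall x : Om, extd (extd x) = 0;
  extd_leibniz : forall n (x y : Om), homog n x ->
    extd (x * y) = extd x * y + (-1) ^+ n *: (x * extd y);
  ext_deg1_span : forall x : Om, homog 1 x ->
    exists s : seq (A * A), x = \sum_(p <- s) ext_incl p.1 * extd (ext_incl p.2);
  ext_generated : forall S : {pred Om}, subalg_closed S ->
    (forall a, ext_incl a \in S) -> (forall x, homog 1 x -> x \in S) ->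
    forall x, x \in S
}.

#[short(type="extAlgType")]
HB.structure Definition ExteriorAlgebra (k : fieldType) (A : algType k) :=
  {Om of GradedAlgebra k Om & isExterior k A Om}.

(** The super grading is the form degree modulo 2. *)
HB.mixin Record isSuperHopf (k : fieldType) Om of GradedAlgebra k Om := {
  scomul : {linear Om -> (Om \ox Om)%type};
  scounit : {scalar Om};
  santipode : {linear Om -> Om};
  scomul_parity : parity_preserving scomul;
  scounit_odd : forall n (x : Om), homog n x -> odd n -> scounit x = 0;
  santipode_parity : parity_preserving santipode;
  scomulA : forall x : Om,
    \tsum_(a, b <- scomul x) \tsum_(c, e <- scomul b) a \ox (c \ox e) =
    \tsum_(a, b <- scomul x) \tsum_(c, e <- scomul a) c \ox (e \ox b);
  scounit_comull : forall x : Om, \tsum_(a, b <- scomul x) scounit a *: b = x;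
  scounit_comulr : forall x : Om, \tsum_(a, b <- scomul x) scounit b *: a = x;
  scomul1 : scomul 1 = 1 \ox 1;
  scomulM : forall x y : Om,
    scomul (x * y) = super_tensor_mul *%R *%R (scomul x) (scomul y);
  scounit1 : scounit 1 = 1;
  scounitM : forall x y : Om, scounit (x * y) = scounit x * scounit y;
  santipodel : forall x : Om,
    \tsum_(a, b <- scomul x) santipode a * b = (scounit x)%:A;
  santipoder : forall x : Om,
    \tsum_(a, b <- scomul x) a * santipode b = (scounit x)%:A
}.

#[short(type="superHopfAlgType")]
HB.structure Definition SuperHopfAlgebra (k : fieldType) :=
  {Om of GradedAlgebra k Om & isSuperHopf k Om}.

HB.mixin Record isStronglyBicovariant (k : fieldType) (A : hopfAlgType k) Om
    of ExteriorAlgebra k A Om & SuperHopfAlgebra k Om := {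
  scomul_degree : degree_preserving (scomul : Om -> Om \ox Om);
  scomul_incl : forall a : A,
    scomul (ext_incl a : Om) = tmap ext_incl ext_incl (comul a);
  scomul_extd : forall x : Om,
    scomul (extd x : Om) = super_tensor_d extd extd (scomul x)
}.

#[short(type="bicovExtAlgType")]
HB.structure Definition StronglyBicovariant (k : fieldType) (A : hopfAlgType k) :=
  {Om of ExteriorAlgebra k A Om & SuperHopfAlgebra k Om
       & isStronglyBicovariant k A Om}.

Section Bicrossproduct.
Variables (k : fieldType) (A H : hopfAlgType k).
Variable act : {linear (H \ox A)%type -> A}.
Variable beta : {linear H -> (H \ox A)%type}.
Local Notation "h |> a" := (act (h \ox a)) (at level 38, no associativity).

Definition module_algebra : Prop :=
  [/\ forall h g a, (h * g) |> a = h |> (g |> a),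
      forall a, 1 |> a = a,
      forall h a b,
        h |> (a * b) = \tsum_(h1, h2 <- comul h) (h1 |> a) * (h2 |> b)
    & forall h, h |> 1 = (counit h)%:A].

Definition comodule_coalgebra : Prop :=
  [/\ forall h,
        \tsum_(g, a <- beta h) \tsum_(f, b <- beta g) f \ox (b \ox a) =
        \tsum_(g, a <- beta h) \tsum_(b, c <- comul a) g \ox (b \ox c),
      forall h, \tsum_(g, a <- beta h) counit a *: g = h,
      forall h,
        \tsum_(g, a <- beta h) comul g \ox a =
        \tsum_(h1, h2 <- comul h) \tsum_(g1, a1 <- beta h1)
          \tsum_(g2, a2 <- beta h2) (g1 \ox g2) \ox (a1 * a2)
    & forall h, \tsum_(g, a <- beta h) counit g *: a = (counit h)%:A].

Record bicrossproduct_pair : Prop := BicrossproductPair {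
  bic_module : module_algebra;
  bic_comodule : comodule_coalgebra;
  bic_beta1 : beta 1 = 1 \ox 1;
  bic_counit : forall h a, counit (h |> a) = counit h * counit a;
  bic_comul : forall h a,
    comul (h |> a) =
    \tsum_(h1, h2 <- comul h) \tsum_(h10, h11 <- beta h1)
      \tsum_(a1, a2 <- comul a) (h10 |> a1) \ox (h11 * (h2 |> a2));
  bic_betaM : forall h g,
    beta (h * g) =
    \tsum_(h1, h2 <- comul h) \tsum_(h10, h11 <- beta h1)
      \tsum_(g0, g1 <- beta g) (h10 * g0) \ox (h11 * (h2 |> g1));
  bic_comm : forall h a,
    \tsum_(h1, h2 <- comul h) \tsum_(h20, h21 <- beta h2)
      h20 \ox ((h1 |> a) * h21) =
    \tsum_(h1, h2 <- comul h) \tsum_(h10, h11 <- beta h1)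
      h10 \ox (h11 * (h2 |> a))
}.

Definition bicross_mul (x y : A \ox H) : A \ox H :=
  \tsum_(a, h <- x) \tsum_(b, g <- y) \tsum_(h1, h2 <- comul h)
    (a * (h1 |> b)) \ox (h2 * g).

Definition bicross_comul (x : A \ox H) : (A \ox H) \ox (A \ox H) :=
  \tsum_(a, h <- x) \tsum_(a1, a2 <- comul a) \tsum_(h1, h2 <- comul h)
    \tsum_(h10, h11 <- beta h1) (a1 \ox h10) \ox ((a2 * h11) \ox h2).

Definition bicross_counit (x : A \ox H) : k :=
  tlift (W := k^o) (fun a h => counit a * counit h) x.

Definition bicross_coaction (h : H) : H \ox (A \ox H) :=
  \tsum_(h1, h2 <- comul h) \tsum_(h10, h11 <- beta h1) h10 \ox (h11 \ox h2).

End Bicrossproduct.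

Section Super.
Variables (k : fieldType) (OmA OmH : superHopfAlgType k).
Variable act : {linear (OmH \ox OmA)%type -> OmA}.
Variable beta : {linear OmH -> (OmH \ox OmA)%type}.
Local Notation "h |> a" := (act (h \ox a)) (at level 38, no associativity).

Definition super_module_algebra : Prop :=
  [/\ forall eta xi om, (eta * xi) |> om = eta |> (xi |> om),
      forall om, 1 |> om = om,
      forall n eta om tau, homog n om ->
        eta |> (om * tau) =
        \hsum_(eta1 @ i, eta2 @ j <- scomul eta)
          (-1) ^+ (j * n) *: ((eta1 |> om) * (eta2 |> tau))
    & forall eta, eta |> 1 = (scounit eta)%:A].

Definition super_comodule_coalgebra : Prop :=
  [/\ forall eta,
        \tsum_(xi, om <- beta eta) \tsum_(zeta, tau <- beta xi)
          zeta \ox (tau \ox om) =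
        \tsum_(xi, om <- beta eta) \tsum_(om1, om2 <- scomul om)
          xi \ox (om1 \ox om2),
      forall eta, \tsum_(xi, om <- beta eta) scounit om *: xi = eta,
      forall eta,
        \tsum_(xi, om <- beta eta) scomul xi \ox om =
        \hsum_(eta1 @ i1, eta2 @ i2 <- scomul eta)
          \hsum_(eta10 @ p0, eta11 @ p1 <- beta eta1)
          \hsum_(eta20 @ q0, eta21 @ q1 <- beta eta2)
            (-1) ^+ (q0 * p1) *: ((eta10 \ox eta20) \ox (eta11 * eta21))
    & forall eta,
        \tsum_(xi, om <- beta eta) scounit xi *: om = (scounit eta)%:A].

Definition super_bicross_mul (x y : OmA \ox OmH) : OmA \ox OmH :=
  \hsum_(om @ m, eta @ n <- x) \hsum_(tau @ p, xi @ q <- y)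
    \hsum_(eta1 @ i, eta2 @ j <- scomul eta)
      (-1) ^+ (j * p) *: ((om * (eta1 |> tau)) \ox (eta2 * xi)).

End Super.

(** The operations of a bialgebra and of a differential graded algebra, used
    for bicrossproducts, whose operations depend on the action and coaction. *)
Record bialgData (k : fieldType) := BialgData {
  bd_car :> lmodType k;
  bd_mul : bd_car -> bd_car -> bd_car;
  bd_one : bd_car;
  bd_comul : bd_car -> bd_car \ox bd_car;
  bd_counit : bd_car -> k
}.

Record dgaData (k : fieldType) := DgaData {
  dg_car :> gmodType k;
  dg_mul : dg_car -> dg_car -> dg_car;
  dg_one : dg_car;
  dg_d : dg_car -> dg_car
}.

Definition bicross_bialg (k : fieldType) (A H : hopfAlgType k)
    (act : {linear (H \ox A)%type -> A})
    (beta : {linear H -> (H \ox A)%type}) : bialgData k :=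
  @BialgData k (A \ox H)%type (bicross_mul act) (1 \ox 1)
    (bicross_comul beta) (@bicross_counit k A H).

Definition super_bicross_dga (k : fieldType) (A H : hopfAlgType k)
    (OmA : bicovExtAlgType A) (OmH : bicovExtAlgType H)
    (act : {linear (OmH \ox OmA)%type -> OmA}) : dgaData k :=
  @DgaData k (OmA \ox OmH)%type (super_bicross_mul act) (1 \ox 1)
    (super_tensor_d extd extd).

Section Differentiable.
Variables (k : fieldType) (B : algType k) (OmB : extAlgType B).
Variables (K : bialgData k) (OmK : dgaData k) (inclK : K -> OmK).

Record comodule_algebra (rho : B -> B \ox K) : Prop := ComoduleAlgebra {
  coact_linear : linear rho;
  coactA : forall b,
    \tsum_(c, x <- rho b) \tsum_(e, y <- rho c) e \ox (y \ox x) =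
    \tsum_(c, x <- rho b) \tsum_(y, z <- bd_comul x) c \ox (y \ox z);
  coact_counit : forall b, \tsum_(c, x <- rho b) bd_counit x *: c = b;
  coact1 : rho 1 = 1 \ox bd_one K;
  coactM : forall b c, rho (b * c) = tensor_mul *%R (@bd_mul k K) (rho b) (rho c)
}.

Record dga_extension (rho : B -> B \ox K) (f : OmB -> OmB \ox OmK) : Prop :=
  DgaExtension {
  dgaext_linear : linear f;
  dgaext_incl : forall b, f (ext_incl b) = tmap ext_incl inclK (rho b);
  dgaext_degree : degree_preserving f;
  dgaext1 : f 1 = 1 \ox dg_one OmK;
  dgaextM : forall x y,
    f (x * y) = super_tensor_mul *%R (@dg_mul k OmK) (f x) (f y);
  dgaext_d : forall x, f (extd x) = super_tensor_d extd (@dg_d k OmK) (f x)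
}.

Definition differentiable_coaction (rho : B -> B \ox K) : Prop :=
  comodule_algebra rho /\ exists f, dga_extension rho f.

End Differentiable.

(* Main.v *)
Require Import Defs.
From HB Require Import structures.
From mathcomp Require Import all_boot all_order all_algebra.
Set Implicit Arguments.
Unset Strict Implicit.
Unset Printing Implicit Defensive.
Import GRing.Theory.
Local Open Scope ring_scope.

(** Write [rho] for the coaction [h |-> h_(1)^(0) (x) h_(1)^(1) (x) h_(2)].  It is
    the restriction to [H] of the coproduct of the bicrossproduct, once [H] is
    identified with [1 (x) H], which explains why it is a coaction and why no
    choice is involved in extending it: the same formula applied to the super
    coproduct and the super coaction, [super_coaction], is the wanted map on
    forms.

    Over the Hopf algebras, [rho] is coassociative for the following reason
    ([bicross_coactionA]).  The comodule coalgebra axiom turns the coproduct of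
    [h_(1)^(0)] into [beta] applied to both factors of the coproduct of [h_(1)],
    the coaction axiom turns the iterated [beta] that arises on the first of
    them into a coproduct of [A], and coassociativity of [H] does the rest.
    Multiplicativity is exactly the compatibility formula for [beta (h g)]: both
    [rho (h g)] and [rho h * rho g] are
      [h_(1)^(0) g_(1)^(0) (x) h_(1)^(1) (h_(2) |> g_(1)^(1)) (x) h_(3) g_(2)],
    up to coassociativity ([bicross_coactionM]).

    On forms the same computation is valid with signs ([super_coactionM]).  The
    exponents on the two sides agree as natural numbers, as soon as the degree
    of a form is known to be the sum of the degrees of the tensor factors of its
    coproduct or of its image under [beta]; this is where degree preservation
    enters, through [hsum_eq_deg].  Commutation with the differential
    ([super_coaction_d]) uses in the same way that the coproduct and [beta]
    commute with [d] separately.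

    Sums in Sweedler notation are manipulated as follows.  A sum over a tensor
    is a sum over some representative, so that it commutes with linear maps and
    with other such sums unconditionally; bilinearity of the summand matters
    only when the tensor is itself replaced by an equal expression.  The tactic
    [lin] proves these bilinearity conditions from the shape of the summand. *)

(** * Multilinear expressions *)

Section LinearFun.
Variables (k : fieldType) (U V : lmodType k) (f : U -> V).
Hypothesis fL : linear f.

Definition lin_fun : {linear U -> V} :=
  HB.pack f (GRing.isLinear.Build k U V *:%R f fL).

Lemma linear_zero : f 0 = 0.
Proof. exact: (linear0 lin_fun). Qed.

Lemma linear_add u v : f (u + v) = f u + f v.
Proof. exact: (linearD lin_fun). Qed.

Lemma linear_scale c u : f (c *: u) = c *: f u.
Proof. by rewrite -[c *: u]addr0 fL linear_zero addr0. Qed.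

Lemma linear_big I (r : seq I) (F : I -> U) :
  f (\sum_(i <- r) F i) = \sum_(i <- r) f (F i).
Proof. exact: (linear_sum lin_fun). Qed.

End LinearFun.

Section Linear.
Variables (k : fieldType) (X U V W : lmodType k).

Lemma bilinP (f : U -> V -> W) :
  (forall v, linear (fun u => f u v)) -> (forall u, linear (fun v => f u v)) ->
  bilinear_for *:%R *:%R f.
Proof. by move=> fl fr; split=> [v|u] c x y /=; [exact: fl|exact: fr]. Qed.

Lemma lin_id : linear (fun x : X => x). Proof. by []. Qed.

Lemma lin_comp (g : U -> W) (f : X -> U) :
  linear g -> linear f -> linear (fun x => g (f x)).
Proof. by move=> gL fL c x y; rewrite fL gL. Qed.

Lemma lin_scale c (f : X -> W) : linear f -> linear (fun x => c *: f x).
Proof. by move=> fL b x y; rewrite fL scalerDr !scalerA mulrC. Qed.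

Lemma lin_add (f g : X -> W) :
  linear f -> linear g -> linear (fun x => f x + g x).
Proof. by move=> fL gL b x y; rewrite fL gL scalerDr addrACA. Qed.

Lemma lin_pure_l (f : X -> U) (v : V) : linear f -> linear (fun x => f x \ox v).
Proof. by move=> fL c x y; rewrite fL linearPl. Qed.

Lemma lin_pure_r (u : U) (f : X -> V) : linear f -> linear (fun x => u \ox f x).
Proof. by move=> fL c x y; rewrite fL linearPr. Qed.

Lemma lin_sum I (r : seq I) (F : X -> I -> W) :
  (forall i, linear (F^~ i)) -> linear (fun x => \sum_(i <- r) F x i).
Proof.
move=> FL c x y; rewrite scaler_sumr -big_split; apply: eq_bigr => i _.
exact: FL.
Qed.

Lemma lin_tsum (F : X -> U -> V -> W) (t : U \ox V) :
  (forall u v, linear (fun x => F x u v)) -> linear (fun x => tlift (F x) t).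
Proof. by move=> FL; apply: lin_sum => p; apply: FL. Qed.

End Linear.

Lemma lin_tsum_arg (k : fieldType) (X U V W : lmodType k)
    (F : U -> V -> W) (f : X -> U \ox V) :
  bilinear_for *:%R *:%R F -> linear f -> linear (fun x => tlift F (f x)).
Proof. by move=> FB fL; exact: (lin_comp (tlift_linear FB) fL). Qed.

Section LinearAlg.
Variables (k : fieldType) (X : lmodType k) (B : algType k).

Lemma lin_mul_l (f : X -> B) (b : B) : linear f -> linear (fun x => f x * b).
Proof. by move=> fL c x y; rewrite fL mulrDl scalerAl. Qed.

Lemma lin_mul_r (a : B) (f : X -> B) : linear f -> linear (fun x => a * f x).
Proof. by move=> fL c x y; rewrite fL mulrDr scalerAr. Qed.

End LinearAlg.

Section LinearGraded.
Variables (k : fieldType) (X : lmodType k) (U V : gmodType k) (W : lmodType k).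

Lemma lin_hsum (F : X -> nat -> nat -> U -> V -> W) (t : U \ox V) :
  (forall i j u v, linear (fun x => F x i j u v)) ->
  linear (fun x => hsum (F x) t).
Proof.
move=> FL; apply: lin_tsum => u v.
by apply: lin_sum => i; apply: lin_sum => j; apply: FL.
Qed.

Lemma lin_hsum_arg (F : nat -> nat -> U -> V -> W) (f : X -> U \ox V) :
  (forall i j, bilinear_for *:%R *:%R (F i j)) -> linear f ->
  linear (fun x => hsum F (f x)).
Proof. by move=> FB fL; exact: (lin_comp (hsum_linear FB) fL). Qed.

End LinearGraded.

Ltac lin_leaf := first [exact: linearP | solve [auto] | idtac].

(** Proves linearity and bilinearity of an expression by recursion on its head
    symbol.  Linearity of maps that are not bundled is taken from the local
    context, and the leaves that remain undecided are left as goals.  The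
    patterns only inspect the head of the body: which argument contains the
    bound variable is decided by the unification in the closure lemmas. *)
Ltac lin := cbn beta; lazymatch goal with
| |- forall _, _ => intro; lin
| |- bilinear_for _ _ _ => first [assumption | apply: bilinP => ?; lin]
(* Unification leaves partial applications in eta-reduced form. *)
| |- GRing.linear_for _ (tpure _) => exact: linearPr
| |- GRing.linear_for _ (GRing.mul _) =>
    apply: (@lin_mul_r _ _ _ _ (fun x => x)); exact: lin_id
| |- GRing.linear_for _ (fun x => x) => apply: lin_id
| |- GRing.linear_for _ (fun x => _ *: _) => first [apply: lin_scale; lin | idtac]
| |- GRing.linear_for _ (fun x => _ + _) => apply: lin_add; lin
| |- GRing.linear_for _ (fun x => tpure _ _) =>
    first [apply: lin_pure_r | apply: lin_pure_l]; lin
| |- GRing.linear_for _ (fun x => _ * _) =>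
    first [apply: lin_mul_r | apply: lin_mul_l]; lin
| |- GRing.linear_for _ (fun x => tlift _ _) =>
    first [apply: lin_tsum | apply: lin_tsum_arg]; lin
| |- GRing.linear_for _ (fun x => hsum _ _) =>
    first [apply: lin_hsum | apply: lin_hsum_arg]; lin
| |- GRing.linear_for _ (fun x => ?g x) => lin_leaf
| |- GRing.linear_for _ (fun x => ?g _) =>
    first [solve [auto] | apply: (lin_comp (g := g)); [lin_leaf | lin] | idtac]
| |- GRing.linear_for _ _ => lin_leaf
| |- _ => idtac
end.

(** * Sweedler sums *)

Section Tsum.
Variables (k : fieldType) (U V W : lmodType k).

Lemma linear_tsum (W' : lmodType k) (L : W -> W') (F : U -> V -> W) t :
  linear L -> L (tlift F t) = tlift (fun u v => L (F u v)) t.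
Proof. by move=> LL; exact: linear_big. Qed.

Lemma tsum_eq (F G : U -> V -> W) t :
  (forall u v, F u v = G u v) -> tlift F t = tlift G t.
Proof. by move=> E; apply: eq_bigr => p _. Qed.

Lemma tsum_exchange (U' V' : lmodType k) (F : U -> V -> U' -> V' -> W) t t' :
  \tsum_(u, v <- t) \tsum_(u', v' <- t') F u v u' v' =
  \tsum_(u', v' <- t') \tsum_(u, v <- t) F u v u' v'.
Proof. exact: exchange_big. Qed.

End Tsum.

(** Coassociativity of [H] under an arbitrary trilinear test map [G], the form
    in which it is used inside longer Sweedler expressions. *)
Lemma tsum_coassoc (k : fieldType) (H : hopfAlgType k) (W : lmodType k)
    (G : H -> H -> H -> W) (h : H) :
  (forall b c, linear (fun a => G a b c)) ->
  (forall a c, linear (fun b => G a b c)) ->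
  (forall a b, linear (fun c => G a b c)) ->
  \tsum_(a, b <- comul h) \tsum_(c, e <- comul a) G c e b =
  \tsum_(a, b <- comul h) \tsum_(c, e <- comul b) G a c e.
Proof.
move=> G1 G2 G3.
pose L (x : H \ox (H \ox H)) := \tsum_(a, t <- x) \tsum_(b, c <- t) G a b c.
have GB a : bilinear_for *:%R *:%R (G a) by apply: bilinP.
have LB : bilinear_for *:%R *:%R (fun a t => \tsum_(b, c <- t) G a b c).
  by apply: bilinP => [t|a]; lin.
have LL : linear L by rewrite /L; lin.
have /(congr1 L) := comulA h.
rewrite !(linear_tsum _ _ LL).
under tsum_eq => a b do rewrite (linear_tsum _ _ LL).
under [RHS]tsum_eq => a b do rewrite (linear_tsum _ _ LL).
rewrite /L => E; symmetry; etransitivity; [etransitivity; [|exact: E] |];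
  by apply: tsum_eq => a b /=; apply: tsum_eq => c e; rewrite !tliftE.
Qed.

(** * Sweedler sums over homogeneous components *)

Section Hsum.
Variables (k : fieldType) (U V : gmodType k) (W : lmodType k).
Implicit Types (F G : nat -> nat -> U -> V -> W) (t : U \ox V).

Lemma hsum_eq F G t :
  (forall i j u v, homog i u -> homog j v -> F i j u v = G i j u v) ->
  hsum F t = hsum G t.
Proof.
move=> E; apply: tsum_eq => u v; apply: eq_bigr => i _; apply: eq_bigr => j _.
by apply: E; exact: homog_gpr.
Qed.

Lemma linear_hsum (W' : lmodType k) (L : W -> W') F t :
  linear L -> L (hsum F t) = hsum (fun i j u v => L (F i j u v)) t.
Proof.
move=> LL; rewrite /hsum (linear_tsum _ _ LL); apply: tsum_eq => u v.
by rewrite (linear_big LL); apply: eq_bigr => i _; rewrite (linear_big LL).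
Qed.

Lemma hsum_scale c F t :
  c *: hsum F t = hsum (fun i j u v => c *: F i j u v) t.
Proof.
by apply: (linear_hsum (L := *:%R c)) => b x y; rewrite scalerDr !scalerA mulrC.
Qed.

Lemma sum_hsum I (r : seq I) (F : I -> nat -> nat -> U -> V -> W) t :
  \sum_(l <- r) hsum (F l) t = hsum (fun i j u v => \sum_(l <- r) F l i j u v) t.
Proof.
rewrite /hsum /tlift /fsum exchange_big; apply: eq_bigr => p _ /=.
by rewrite exchange_big; apply: eq_bigr => i _; rewrite exchange_big.
Qed.

Lemma hsum_add F G t :
  hsum F t + hsum G t = hsum (fun i j u v => F i j u v + G i j u v) t.
Proof.
rewrite /hsum /tlift /fsum -big_split; apply: eq_bigr => p _ /=.
by rewrite -big_split; apply: eq_bigr => i _; rewrite -big_split.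
Qed.

End Hsum.

Lemma hsum_exchange (k : fieldType) (U V U' V' : gmodType k) (W : lmodType k)
    (F : nat -> nat -> U -> V -> nat -> nat -> U' -> V' -> W)
    (t : U \ox V) (t' : U' \ox V') :
  \hsum_(u @ i, v @ j <- t) \hsum_(u' @ i', v' @ j' <- t') F i j u v i' j' u' v' =
  \hsum_(u' @ i', v' @ j' <- t') \hsum_(u @ i, v @ j <- t) F i j u v i' j' u' v'.
Proof.
rewrite {1}/hsum /tlift /fsum.
under eq_bigr => p _ do under eq_bigr => i _ do rewrite sum_hsum.
under eq_bigr => p _ do rewrite sum_hsum.
by rewrite sum_hsum.
Qed.

Section HsumDegree.
Variables (k : fieldType) (U V : gmodType k) (W : lmodType k).
Implicit Types (F G : nat -> nat -> U -> V -> W) (t : U \ox V).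

Lemma homog_pure i j (u : U) (v : V) :
  homog i u -> homog j v -> homog (i + j) (u \ox v).
Proof.
move=> hu hv; rewrite /homog /= /tgpr (hsumE _ hu hv) ?eqxx // => p q.
case: eqP => _; first exact: tpure_bilinear.
by split=> [? c ? ?|? c ? ?] /=; rewrite scaler0 addr0.
Qed.

Lemma hsum_tsum (F : U -> V -> W) t :
  bilinear_for *:%R *:%R F -> tlift F t = hsum (fun _ _ => F) t.
Proof.
move=> FB; apply: tsum_eq => u v.
rewrite {1}(homog_sum u) {1}(homog_sum v).
rewrite (linear_big (FB.1 _)); apply: eq_bigr => i _.
exact: (linear_big (FB.2 _)).
Qed.

(** The homogeneous components of a tensor of degree [n] may include pieces of
    other total degrees, which cancel only after summation.  Projecting the
    tensor to degree [n] discards them without changing the sum of a bilinear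
    expression, so that the degrees may be assumed to add up to [n]. *)
Lemma hsum_eq_deg n F G t : homog n t ->
  (forall i j, bilinear_for *:%R *:%R (F i j)) ->
  (forall i j, bilinear_for *:%R *:%R (G i j)) ->
  (forall i j u v, homog i u -> homog j v -> (i + j)%N = n -> F i j u v = G i j u v) ->
  hsum F t = hsum G t.
Proof.
move=> ht FB GB E; rewrite -ht /= /tgpr.
rewrite (linear_hsum _ _ (hsum_linear FB)) (linear_hsum _ _ (hsum_linear GB)).
apply: hsum_eq => i j u v hu hv; case: eqP => [e|_].
  by rewrite !(hsumE _ hu hv) // E.
by rewrite (linear_zero (hsum_linear FB)) (linear_zero (hsum_linear GB)).
Qed.

End HsumDegree.

Lemma homog_hsum (k : fieldType) (U V W : gmodType k)
    (F : nat -> nat -> U -> V -> W) n m t : homog n t ->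
  (forall i j, bilinear_for *:%R *:%R (F i j)) ->
  (forall i j u v, homog i u -> homog j v -> (i + j)%N = n -> homog m (F i j u v)) ->
  homog m (hsum F t).
Proof.
move=> ht FB Fh; rewrite /homog (linear_hsum _ _ (L := gpr m)); last exact: linearP.
apply: (hsum_eq_deg ht) => // i j; apply: bilinP => [v|u].
  exact: (lin_comp (g := gpr m) (linearP _) ((FB i j).1 v)).
exact: (lin_comp (g := gpr m) (linearP _) ((FB i j).2 u)).
Qed.

(** The graded analogue of [tsum_coassoc]; the test map may depend on the three
    degrees, as the signs do. *)
Lemma hsum_coassoc (k : fieldType) (Om : superHopfAlgType k) (W : lmodType k)
    (G : nat -> nat -> nat -> Om -> Om -> Om -> W) (x : Om) :
  (forall i p q b c, linear (fun a => G i p q a b c)) ->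
  (forall i p q a c, linear (fun b => G i p q a b c)) ->
  (forall i p q a b, linear (fun c => G i p q a b c)) ->
  \hsum_(a @ i, b @ j <- scomul x) \hsum_(c @ p, e @ q <- scomul a) G p q j c e b =
  \hsum_(a @ i, b @ j <- scomul x) \hsum_(c @ p, e @ q <- scomul b) G i p q a c e.
Proof.
move=> G1 G2 G3.
pose L (t : Om \ox (Om \ox Om)) :=
  \hsum_(a @ i, u @ j <- t) \hsum_(b @ p, c @ q <- u) G i p q a b c.
have GB i p q a : bilinear_for *:%R *:%R (G i p q a) by apply: bilinP.
have LB i (j : nat) : bilinear_for *:%R *:%R
    (fun a (u : (Om \ox Om)%type) => \hsum_(b @ p, c @ q <- u) G i p q a b c).
  by apply: bilinP => [t|a]; lin.
have LL : linear L by exact: hsum_linear.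
have LE i p q a b c : homog i a -> homog p b -> homog q c ->
    L (a \ox (b \ox c)) = G i p q a b c.
  move=> ha hb hc.
  by rewrite /L (hsumE _ ha (homog_pure hb hc)) // (hsumE _ hb hc).
have := scomulA x.
rewrite [LHS]hsum_tsum; last by lin.
rewrite [RHS]hsum_tsum; last by lin.
move/(congr1 L); rewrite !(linear_hsum _ _ LL) => E; symmetry.
etransitivity; [etransitivity; [|exact: E]|]; apply: hsum_eq => i j a b ha hb.
- rewrite hsum_tsum; last by lin.
  by rewrite (linear_hsum _ _ LL); apply: hsum_eq => p q c e hc he; rewrite (LE i p q).
- rewrite hsum_tsum; last by lin.
  by rewrite (linear_hsum _ _ LL); apply: hsum_eq => p q c e hc he; rewrite (LE p q j).
Qed.

(** * The coaction of the bicrossproduct *)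

Section CoactionComodule.
Variables (k : fieldType) (A H : hopfAlgType k).
Variable act : {linear (H \ox A)%type -> A}.
Variable beta : {linear H -> (H \ox A)%type}.
Hypothesis bicross : bicrossproduct_pair act beta.
Local Notation rho := (bicross_coaction beta).

Lemma bicross_coaction_linear : linear rho.
Proof. by rewrite /bicross_coaction; lin. Qed.

Lemma bicross_coaction1 : rho 1 = 1 \ox (1 \ox 1).
Proof.
rewrite /bicross_coaction comul1 tliftE; last by lin.
by rewrite (bic_beta1 bicross) tliftE //; lin.
Qed.

Lemma bicross_coaction_tsum (W : lmodType k) (F : H -> A \ox H -> W) h :
  bilinear_for *:%R *:%R F ->
  \tsum_(c, x <- rho h) F c x =
  \tsum_(h1, h2 <- comul h) \tsum_(h10, h11 <- beta h1) F h10 (h11 \ox h2).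
Proof.
move=> FB; rewrite /bicross_coaction (linear_tsum _ _ (tlift_linear FB)).
apply: tsum_eq => h1 h2; rewrite (linear_tsum _ _ (tlift_linear FB)).
by apply: tsum_eq => h10 h11; rewrite tliftE.
Qed.

Let counit_bilinear : bilinear_for *:%R *:%R
  (fun (a : A) (h : H) => counit a * counit h : k^o).
Proof.
apply: bilinP => [h|a] c x y; rewrite linearP; first by rewrite mulrDl -mulrA.
by rewrite mulrDr mulrCA.
Qed.

Lemma bicross_counit_linear : linear (@bicross_counit k A H : A \ox H -> k^o).
Proof. exact: tlift_linear counit_bilinear. Qed.

Lemma bicross_counit_pure (a : A) (h : H) :
  bicross_counit (a \ox h) = counit a * counit h.
Proof. exact: tliftE counit_bilinear a h. Qed.

Lemma bicross_coaction_counit h :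
  \tsum_(c, x <- rho h) bicross_counit x *: c = h.
Proof.
have [_ beta_counit _ _] := bic_comodule bicross.
rewrite bicross_coaction_tsum; last first.
  apply: bilinP => [x|c]; lin.
  by move=> b x y; rewrite bicross_counit_linear scalerDl scalerA.
rewrite -[RHS](counit_comulr h); apply: tsum_eq => h1 h2.
rewrite -[in RHS](beta_counit h1) (linear_tsum (L := *:%R (counit h2))); last by lin.
apply: tsum_eq => g a.
by rewrite bicross_counit_pure scalerA mulrC.
Qed.

(** With [h_(i)] the factors of the iterated coproduct of [b], both sides are
      [h_(1)^(0) (x) (h_(1)^(1)_(1) (x) h_(2)^(0))
                 (x) (h_(1)^(1)_(2) h_(2)^(1) (x) h_(3))]. *)
Lemma bicross_coactionA b :
  \tsum_(c, x <- rho b) \tsum_(e, y <- rho c) e \ox (y \ox x) =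
  \tsum_(c, x <- rho b) \tsum_(y, z <- bicross_comul beta x) c \ox (y \ox z).
Proof.
have [beta_coassoc _ beta_comul _] := bic_comodule bicross.
have coact_pair (h2 g : H) (a : A) :
    \tsum_(e, y <- rho g) e \ox (y \ox (a \ox h2)) =
    \tsum_(u, v <- comul g) \tsum_(u0, u1 <- beta u)
       u0 \ox ((u1 \ox v) \ox (a \ox h2)).
  by rewrite bicross_coaction_tsum //; lin.
have comulL : linear (bicross_comul beta) by rewrite /bicross_comul; lin.
have rhoL := bicross_coaction_linear.
rewrite [LHS]bicross_coaction_tsum; last by lin.
rewrite [RHS]bicross_coaction_tsum; last by lin.
(* The comodule coalgebra axiom splits the coproduct of [h_(1)^(0)]. *)
transitivity (
  \tsum_(h1, h2 <- comul b) \tsum_(k1, k2 <- comul h1)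
    \tsum_(g1, a1 <- beta k1) \tsum_(g2, a2 <- beta k2)
      \tsum_(u0, u1 <- beta g1) u0 \ox ((u1 \ox g2) \ox ((a1 * a2) \ox h2))).
  apply: tsum_eq => h1 h2.
  under tsum_eq => g a do rewrite coact_pair.
  pose L (x : (H \ox H) \ox A) := \tsum_(t, a <- x)
    \tsum_(u, v <- t) \tsum_(u0, u1 <- beta u)
       u0 \ox ((u1 \ox v) \ox (a \ox h2)).
  have LB : bilinear_for *:%R *:%R (fun (t : (H \ox H)%type) (a : A) =>
    \tsum_(u, v <- t) \tsum_(u0, u1 <- beta u)
       u0 \ox ((u1 \ox v) \ox (a \ox h2))) by lin.
  have LL : linear L by exact: tlift_linear.
  have /(congr1 L) := beta_comul h1.
  rewrite (linear_tsum _ _ LL) => E.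
  transitivity (\tsum_(g, a <- beta h1) L (comul g \ox a)).
    by apply: tsum_eq => g a; rewrite /L tliftE.
  rewrite E (linear_tsum _ _ LL); apply: tsum_eq => k1 k2.
  rewrite (linear_tsum _ _ LL); apply: tsum_eq => g1 a1.
  rewrite (linear_tsum _ _ LL); apply: tsum_eq => g2 a2.
  by rewrite /L tliftE // tliftE //; lin.
(* The coaction axiom trades the second [beta] for a coproduct of [A]. *)
transitivity (
  \tsum_(h1, h2 <- comul b) \tsum_(k1, k2 <- comul h1)
    \tsum_(g2, a2 <- beta k2) \tsum_(g1, a1 <- beta k1)
      \tsum_(b1, b2 <- comul a1) g1 \ox ((b1 \ox g2) \ox ((b2 * a2) \ox h2))).
  apply: tsum_eq => h1 h2; apply: tsum_eq => k1 k2.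
  rewrite tsum_exchange; apply: tsum_eq => g2 a2.
  pose L (x : H \ox (A \ox A)) := \tsum_(u, t <- x) \tsum_(b1, b2 <- t)
       u \ox ((b1 \ox g2) \ox ((b2 * a2) \ox h2)).
  have LB : bilinear_for *:%R *:%R (fun (u : H) (t : (A \ox A)%type) =>
    \tsum_(b1, b2 <- t) u \ox ((b1 \ox g2) \ox ((b2 * a2) \ox h2))) by lin.
  have LL : linear L by exact: tlift_linear.
  have /(congr1 L) := beta_coassoc k1.
  rewrite !(linear_tsum _ _ LL) => E.
  transitivity (\tsum_(g, a <- beta k1) L (\tsum_(f, b <- beta g) f \ox (b \ox a))).
    apply: tsum_eq => g a; rewrite (linear_tsum _ _ LL); apply: tsum_eq => u0 u1.
    by rewrite /L tliftE // tliftE //; lin.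
  rewrite E; apply: tsum_eq => g a; rewrite (linear_tsum _ _ LL).
  by apply: tsum_eq => b1 b2; rewrite /L tliftE // tliftE //; lin.
rewrite (tsum_coassoc (G := fun k1 k2 h2 =>
    \tsum_(g2, a2 <- beta k2) \tsum_(g1, a1 <- beta k1) \tsum_(b1, b2 <- comul a1)
      g1 \ox ((b1 \ox g2) \ox ((b2 * a2) \ox h2)))); try by lin.
apply: tsum_eq => h1 h2.
transitivity (\tsum_(h10, h11 <- beta h1) \tsum_(a1, a2 <- comul h11)
  \tsum_(k1, k2 <- comul h2) \tsum_(k10, k11 <- beta k1)
   h10 \ox ((a1 \ox k10) \ox ((a2 * k11) \ox k2))).
  under tsum_eq => k1 k2 do rewrite tsum_exchange.
  rewrite tsum_exchange; apply: tsum_eq => g1 a1.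
  under tsum_eq => k1 k2 do rewrite tsum_exchange.
  by rewrite tsum_exchange.
apply: tsum_eq => h10 h11.
rewrite /bicross_comul tliftE; last by lin.
have LB : bilinear_for *:%R *:%R
   (fun y z : (A \ox H)%type => h10 \ox (y \ox z)) by lin.
have LL := tlift_linear LB.
rewrite (linear_tsum _ _ LL); apply: tsum_eq => a1 a2.
rewrite (linear_tsum _ _ LL); apply: tsum_eq => k1 k2.
rewrite (linear_tsum _ _ LL); apply: tsum_eq => k10 k11.
by rewrite tliftE.
Qed.

Lemma bicross_mul_linearl y : linear ((bicross_mul act)^~ y).
Proof. by rewrite /bicross_mul; lin. Qed.

Lemma bicross_mul_linearr x : linear (bicross_mul act x).
Proof. by rewrite /bicross_mul; lin. Qed.

Lemma bicross_mul_pure a b h g :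
  bicross_mul act (a \ox h) (b \ox g) =
  \tsum_(h1, h2 <- comul h) (a * act (h1 \ox b)) \ox (h2 * g).
Proof. by rewrite /bicross_mul tliftE ?tliftE //; lin. Qed.

(** In [rho (h * g)] the compatibility formula for [beta (h_(1) * g_(1))] makes
    the second factor of the coproduct of [h_(1)] act, in the product of the
    bicrossproduct it is the first factor of the coproduct of [h_(2)] that acts;
    coassociativity identifies the two. *)
Lemma bicross_coactionM h g :
  rho (h * g) = tensor_mul *%R (bicross_mul act) (rho h) (rho g).
Proof.
have mulLl := bicross_mul_linearl; have mulLr := bicross_mul_linearr.
rewrite /tensor_mul [RHS]bicross_coaction_tsum; last by lin.
transitivity (
  \tsum_(h1, h2 <- comul h) \tsum_(h10, h11 <- beta h1)
    \tsum_(g1, g2 <- comul g) \tsum_(g10, g11 <- beta g1)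
      \tsum_(k1, k2 <- comul h2)
        (h10 * g10) \ox ((h11 * act (k1 \ox g11)) \ox (k2 * g2))); last first.
  apply: tsum_eq => h1 h2; apply: tsum_eq => h10 h11.
  rewrite [RHS]bicross_coaction_tsum; last by lin.
  apply: tsum_eq => g1 g2; apply: tsum_eq => g10 g11.
  rewrite bicross_mul_pure (linear_tsum (L := tpure (h10 * g10))) //.
  exact: linearPr.
transitivity (
  \tsum_(h1, h2 <- comul h) \tsum_(k1, k2 <- comul h2)
    \tsum_(h10, h11 <- beta h1)
    \tsum_(g1, g2 <- comul g) \tsum_(g10, g11 <- beta g1)
        (h10 * g10) \ox ((h11 * act (k1 \ox g11)) \ox (k2 * g2))); last first.
  apply: tsum_eq => h1 h2; rewrite tsum_exchange; apply: tsum_eq => h10 h11.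
  rewrite tsum_exchange; apply: tsum_eq => g1 g2; exact: tsum_exchange.
rewrite -(tsum_coassoc (G := fun h1 k1 k2 =>
    \tsum_(h10, h11 <- beta h1)
    \tsum_(g1, g2 <- comul g) \tsum_(g10, g11 <- beta g1)
        (h10 * g10) \ox ((h11 * act (k1 \ox g11)) \ox (k2 * g2)))); try by lin.
pose F (a b : H) := \tsum_(h10, h11 <- beta a) h10 \ox (h11 \ox b).
have FB : bilinear_for *:%R *:%R F by rewrite /F; lin.
have LL := tlift_linear FB.
rewrite /bicross_coaction comulM /tensor_mul -/(tlift F _).
rewrite (linear_tsum _ _ LL); apply: tsum_eq => h1 h2.
rewrite (linear_tsum _ _ LL).
under tsum_eq => g1 g2 do rewrite tliftE //.
under [RHS]tsum_eq => k1 k2 do rewrite tsum_exchange.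
rewrite [RHS]tsum_exchange; apply: tsum_eq => g1 g2.
rewrite /F (bic_betaM bicross).
have PB : bilinear_for *:%R *:%R
   (fun (u : H) (v : A) => u \ox (v \ox (h2 * g2))) by lin.
have PL := tlift_linear PB.
rewrite (linear_tsum _ _ PL); apply: tsum_eq => k1 k2.
rewrite (linear_tsum _ _ PL); apply: tsum_eq => h10 h11.
rewrite (linear_tsum _ _ PL); apply: tsum_eq => g10 g11.
by rewrite tliftE.
Qed.

Lemma bicross_coaction_comodule_algebra :
  @comodule_algebra k H (bicross_bialg act beta) rho.
Proof.
split.
- exact: bicross_coaction_linear.
- exact: bicross_coactionA.
- exact: bicross_coaction_counit.
- exact: bicross_coaction1.
- exact: bicross_coactionM.
Qed.

End CoactionComodule.

(** * The coaction on forms *)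

Section SuperCoaction.
Variables (k : fieldType) (OmA OmH : superHopfAlgType k).
Variable beta : {linear OmH -> (OmH \ox OmA)%type}.

(** This is the formula of [bicross_coaction]; no sign appears, as no two forms
    change their order. *)
Definition super_coaction (x : OmH) : OmH \ox (OmA \ox OmH) :=
  \tsum_(x1, x2 <- scomul x) \tsum_(x10, x11 <- beta x1) x10 \ox (x11 \ox x2).

Lemma super_coaction_linear : linear super_coaction.
Proof. by rewrite /super_coaction; lin. Qed.

Lemma super_coactionE x : super_coaction x =
  \hsum_(x1 @ i, x2 @ j <- scomul x) \hsum_(x10 @ p, x11 @ q <- beta x1)
    x10 \ox (x11 \ox x2).
Proof.
rewrite /super_coaction [LHS]hsum_tsum; last by lin.
by apply: hsum_eq => i j x1 x2 _ _; rewrite hsum_tsum //; lin.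
Qed.

Lemma super_coaction_hsum (W : lmodType k)
    (F : nat -> nat -> OmH -> (OmA \ox OmH)%type -> W) x :
  (forall i j, bilinear_for *:%R *:%R (F i j)) ->
  hsum F (super_coaction x) =
  \hsum_(x1 @ i, x2 @ j <- scomul x) \hsum_(x10 @ p, x11 @ q <- beta x1)
    F p (q + j)%N x10 (x11 \ox x2).
Proof.
move=> FB; rewrite super_coactionE (linear_hsum _ _ (hsum_linear FB)).
apply: hsum_eq => i j x1 x2 _ h2; rewrite (linear_hsum _ _ (hsum_linear FB)).
by apply: hsum_eq => p q u v hu hv; rewrite (hsumE _ hu (homog_pure hv h2)).
Qed.

Lemma super_coaction_degree :
  degree_preserving (scomul : OmH -> OmH \ox OmH) -> degree_preserving beta ->
  degree_preserving super_coaction.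
Proof.
move=> comul_deg beta_deg n x hx; rewrite super_coactionE.
apply: (homog_hsum (comul_deg _ _ hx)) => [i j|i j x1 x2 h1 h2 <-]; first by lin.
apply: (homog_hsum (beta_deg _ _ h1)) => [p q|p q u v hu hv <-]; first by lin.
by rewrite -addnA; apply: homog_pure => //; apply: homog_pure.
Qed.

Lemma super_coaction1 : beta 1 = 1 \ox 1 -> super_coaction 1 = 1 \ox (1 \ox 1).
Proof.
move=> b1; rewrite /super_coaction scomul1 tliftE; last by lin.
by rewrite b1 tliftE //; lin.
Qed.

Variable act : {linear (OmH \ox OmA)%type -> OmA}.

Lemma super_bicross_mul_pure m n p q (a b : OmA) (h g : OmH) :
  homog m a -> homog n h -> homog p b -> homog q g ->
  super_bicross_mul act (a \ox h) (b \ox g) =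
  \hsum_(h1 @ i, h2 @ j <- scomul h)
    (-1) ^+ (j * p) *: ((a * act (h1 \ox b)) \ox (h2 * g)).
Proof.
move=> ha hh hb hg; rewrite /super_bicross_mul (hsumE _ ha hh); last by lin.
by rewrite (hsumE _ hb hg) //; lin.
Qed.

(** The common value of both sides, with [k1] and [k2] the factors of the
    coproduct of [x2], is displayed after the first [transitivity]: the sign
    records that [x11], [k1] and [k2] move past [y10], and [k2] past [y11].  On
    the left-hand side the sign [(-1) ^+ (i2 * j1)] of the product of coproducts
    is split along [j1 = q0 + q1], on the right-hand side the sign from moving
    [x2] past [y10] along [i2 = r + s]. *)
Lemma super_coactionM :
  degree_preserving (scomul : OmH -> OmH \ox OmH) -> degree_preserving beta ->
  (forall x y : OmH, beta (x * y) =
     \hsum_(x1 @ i1, x2 @ i2 <- scomul x)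
       \hsum_(x10 @ p0, x11 @ p1 <- beta x1)
       \hsum_(y0 @ q0, y1 @ q1 <- beta y)
         (-1) ^+ ((p1 + i2) * q0) *: ((x10 * y0) \ox (x11 * act (x2 \ox y1)))) ->
  forall x y, super_coaction (x * y) =
    super_tensor_mul *%R (super_bicross_mul act) (super_coaction x) (super_coaction y).
Proof.
move=> comul_deg beta_deg betaM x y.
have mulLl z : linear ((super_bicross_mul act)^~ z) by rewrite /super_bicross_mul; lin.
have mulLr z : linear (super_bicross_mul act z) by rewrite /super_bicross_mul; lin.
transitivity (
  \hsum_(x1 @ i1, x2 @ i2 <- scomul x) \hsum_(k1 @ r, k2 @ s <- scomul x2)
    \hsum_(x10 @ p0, x11 @ p1 <- beta x1)
    \hsum_(y1 @ j1, y2 @ j2 <- scomul y) \hsum_(y10 @ q0, y11 @ q1 <- beta y1)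
      (-1) ^+ ((p1 + (r + s)) * q0 + s * q1) *:
        ((x10 * y10) \ox ((x11 * act (k1 \ox y11)) \ox (k2 * y2)))); last first.
  rewrite /super_tensor_mul [RHS]super_coaction_hsum; last by lin.
  apply: hsum_eq => i1 i2 x1 x2 _ h2; rewrite hsum_exchange.
  apply: hsum_eq => p0 p1 x10 x11 _ h11.
  rewrite [RHS]super_coaction_hsum; last by lin.
  rewrite hsum_exchange; apply: hsum_eq => j1 j2 y1 y2 _ hy2.
  rewrite hsum_exchange; apply: hsum_eq => q0 q1 y10 y11 _ hy11.
  rewrite (super_bicross_mul_pure h11 h2 hy11 hy2).
  rewrite (linear_hsum _ _ (L := fun z => _ *: (x10 * y10 \ox z))); last by lin.
  apply: (hsum_eq_deg (comul_deg _ _ h2)) => [i j|i j|r s k1 k2 hk1 hk2 <-]; try by lin.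
  by rewrite [in RHS]linearZr scalerA exprD.
rewrite -(hsum_coassoc (G := fun i1 r s x1 k1 k2 =>
    \hsum_(x10 @ p0, x11 @ p1 <- beta x1)
    \hsum_(y1 @ j1, y2 @ j2 <- scomul y) \hsum_(y10 @ q0, y11 @ q1 <- beta y1)
      (-1) ^+ ((p1 + (r + s)) * q0 + s * q1) *:
        ((x10 * y10) \ox ((x11 * act (k1 \ox y11)) \ox (k2 * y2))))); try by lin.
pose F (a b : OmH) := \tsum_(a0, a1 <- beta a) a0 \ox (a1 \ox b).
have FB : bilinear_for *:%R *:%R F by rewrite /F; lin.
have FL := tlift_linear FB.
rewrite /super_coaction -/(tlift F _) scomulM /super_tensor_mul.
rewrite (linear_hsum _ _ FL); apply: hsum_eq => i1 i2 x1 x2 hx1 hx2.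
rewrite (linear_hsum _ _ FL).
under [RHS]hsum_eq => r s k1 k2 _ _ do rewrite hsum_exchange.
rewrite [RHS]hsum_exchange; apply: hsum_eq => j1 j2 y1 y2 hy1 hy2.
rewrite (linear_scale FL) tliftE // /F betaM.
pose P (a0 : OmH) (a1 : OmA) := a0 \ox (a1 \ox (x2 * y2)).
have PB : bilinear_for *:%R *:%R P by rewrite /P; lin.
have PL := tlift_linear PB.
have cPL := lin_scale ((-1) ^+ (i2 * j1)) PL.
rewrite -/P (linear_hsum _ _ cPL); apply: hsum_eq => r s k1 k2 _ _.
rewrite (linear_hsum _ _ cPL); apply: hsum_eq => p0 p1 x10 x11 _ _.
rewrite (linear_hsum _ _ cPL).
apply: (hsum_eq_deg (beta_deg _ _ hy1)) => [i j|i j|q0 q1 y10 y11 _ _ <-];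
  try by lin.
cbv beta; rewrite (linear_scale PL) tliftE // scalerA -exprD; congr (_ ^+ _ *: _).
by rewrite mulnDr !mulnDl addnAC [(i2 * q0 + _)%N]addnC !addnA.
Qed.

(** The differential of [super_coaction x] has three terms.  The one that
    differentiates the last factor has the sign of the degree of
    [x_(1)^(0)] plus that of [x_(1)^(1)], while the coproduct of [dH x]
    produces the sign of the degree of [x_(1)]; they agree as [beta] preserves
    degrees. *)
Lemma super_coaction_d (dA : {linear OmA -> OmA}) (dH : {linear OmH -> OmH}) :
  degree_preserving (scomul : OmH -> OmH \ox OmH) -> degree_preserving beta ->
  (forall x, scomul (dH x) = super_tensor_d dH dH (scomul x)) ->
  (forall x, beta (dH x) = super_tensor_d dH dA (beta x)) ->
  forall x, super_coaction (dH x) =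
    super_tensor_d dH (super_tensor_d dA dH) (super_coaction x).
Proof.
move=> comul_deg beta_deg comul_d beta_d x.
have dL : linear (super_tensor_d dA dH) by rewrite /super_tensor_d; lin.
pose F (a b : OmH) := \tsum_(a0, a1 <- beta a) a0 \ox (a1 \ox b).
have FB : bilinear_for *:%R *:%R F by rewrite /F; lin.
have FL := tlift_linear FB.
rewrite {2}/super_tensor_d [RHS]super_coaction_hsum; last by lin.
rewrite /super_coaction -/(tlift F _) comul_d {1}/super_tensor_d.
rewrite (linear_hsum _ _ FL).
apply: hsum_eq => i j x1 x2 h1 h2.
rewrite (linear_add FL) (linear_scale FL) !tliftE // /F beta_d.
pose P (a0 : OmH) (a1 : OmA) := a0 \ox (a1 \ox x2).
have PB : bilinear_for *:%R *:%R P by rewrite /P; lin.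
have PL := tlift_linear PB.
rewrite -/P {1}/super_tensor_d (linear_hsum _ _ PL).
rewrite [X in _ *: X]hsum_tsum; last by lin.
rewrite hsum_scale hsum_add.
apply: (hsum_eq_deg (beta_deg _ _ h1)) => [p q|p q|p q x10 x11 h10 h11 <-];
  try by lin.
rewrite (linear_add PL) (linear_scale PL) !tliftE // /P.
rewrite /super_tensor_d (hsumE _ h11 h2); last by lin.
by rewrite linearDr scalerDr addrA linearZr scalerA exprD.
Qed.

Lemma super_coaction_incl (A H : hopfAlgType k) (b : {linear H -> (H \ox A)%type})
    (iA : {linear A -> OmA}) (iH : {linear H -> OmH}) :
  (forall h, scomul (iH h) = tmap iH iH (comul h)) ->
  (forall h, beta (iH h) = tmap iH iA (b h)) ->
  forall h, super_coaction (iH h) = tmap iH (tmap iA iH) (bicross_coaction b h).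
Proof.
move=> comul_incl beta_incl h.
have iL : linear (tmap iA iH) by rewrite /tmap; lin.
have iiL : linear (tmap iH (tmap iA iH)) by rewrite /tmap; lin.
pose F (a b : OmH) := \tsum_(a0, a1 <- beta a) a0 \ox (a1 \ox b).
have FB : bilinear_for *:%R *:%R F by rewrite /F; lin.
have FL := tlift_linear FB.
rewrite /super_coaction -/(tlift F _) comul_incl {1}/tmap (linear_tsum _ _ FL).
rewrite /bicross_coaction (linear_tsum _ _ iiL); apply: tsum_eq => h1 h2.
rewrite (linear_tsum _ _ iiL) tliftE // /F beta_incl {1}/tmap.
pose P (a0 : OmH) (a1 : OmA) := a0 \ox (a1 \ox iH h2).
have PB : bilinear_for *:%R *:%R P by rewrite /P; lin.
rewrite -/P (linear_tsum _ _ (tlift_linear PB)); apply: tsum_eq => h10 h11.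
by rewrite tliftE // /P /tmap tliftE ?tliftE //; lin.
Qed.

End SuperCoaction.

Theorem corollary5p3 (k : fieldType) (A H : hopfAlgType k)
  (act : {linear (H \ox A)%type -> A}) (beta : {linear H -> (H \ox A)%type})
  (bicross : bicrossproduct_pair act beta)
  (OmA : bicovExtAlgType A) (OmH : bicovExtAlgType H)
  (actO : {linear (OmH \ox OmA)%type -> OmA})
  (actO_extends : forall (h : H) (a : A),
     actO (ext_incl h \ox ext_incl a) = ext_incl (act (h \ox a)))
  (actO_degree : degree_preserving actO)
  (actO_module : super_module_algebra actO)
  (betaO : {linear OmH -> (OmH \ox OmA)%type})
  (betaO_extends : forall h : H,
     betaO (ext_incl h) = tmap ext_incl ext_incl (beta h))
  (betaO_degree : degree_preserving betaO)
  (betaO_comodule : super_comodule_coalgebra betaO)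
  (actO_d : forall n (eta : OmH) (om : OmA), homog n eta ->
     extd (actO (eta \ox om)) =
     actO (extd eta \ox om) + (-1) ^+ n *: actO (eta \ox extd om))
  (betaO_d : forall eta : OmH,
     betaO (extd eta) =
     \hsum_(eta0 @ i, eta1 @ j <- betaO eta)
       (extd eta0 \ox eta1 + (-1) ^+ i *: (eta0 \ox extd eta1)))
  (actO_counit : forall (eta : OmH) (om : OmA),
     scounit (actO (eta \ox om)) = scounit eta * scounit om)
  (actO_comul : forall (eta : OmH) (om : OmA),
     scomul (actO (eta \ox om)) =
     \hsum_(eta1 @ i1, eta2 @ i2 <- scomul eta)
       \hsum_(eta10 @ p0, eta11 @ p1 <- betaO eta1)
       \hsum_(om1 @ m1, om2 @ m2 <- scomul om)
         (-1) ^+ ((p1 + i2) * m1) *: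
           (actO (eta10 \ox om1) \ox (eta11 * actO (eta2 \ox om2))))
  (betaO_mul : forall eta xi : OmH,
     betaO (eta * xi) =
     \hsum_(eta1 @ i1, eta2 @ i2 <- scomul eta)
       \hsum_(eta10 @ p0, eta11 @ p1 <- betaO eta1)
       \hsum_(xi0 @ q0, xi1 @ q1 <- betaO xi)
         (-1) ^+ ((p1 + i2) * q0) *:
           ((eta10 * xi0) \ox (eta11 * actO (eta2 \ox xi1))))
  (actO_betaO : forall n (eta : OmH) (om : OmA), homog n om ->
     \hsum_(eta1 @ i1, eta2 @ i2 <- scomul eta)
       \hsum_(eta20 @ q0, eta21 @ q1 <- betaO eta2)
         (-1) ^+ (n * q1 + i1 * q0) *:
           (eta20 \ox (actO (eta1 \ox om) * eta21)) =
     \hsum_(eta1 @ i1, eta2 @ i2 <- scomul eta)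
       \hsum_(eta10 @ p0, eta11 @ p1 <- betaO eta1)
         (eta10 \ox (eta11 * actO (eta2 \ox om)))) :
  differentiable_coaction (K := bicross_bialg act beta)
    (OmK := super_bicross_dga actO) OmH (tmap ext_incl ext_incl)
    (bicross_coaction beta).
Proof.
split; first exact: bicross_coaction_comodule_algebra bicross.
have comul_deg := @scomul_degree k H OmH.
exists (super_coaction betaO); split.
- exact: super_coaction_linear.
- exact: super_coaction_incl (@scomul_incl k H OmH) betaO_extends.
- exact: super_coaction_degree.
- apply: super_coaction1; rewrite -(rmorph1 (@ext_incl k H OmH)).
  rewrite betaO_extends (bic_beta1 bicross) /tmap tliftE ?rmorph1 //; lin.
- exact: super_coactionM.
- exact: super_coaction_d (@scomul_extd k H OmH) betaO_d.
Qed.
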